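(* Let $\Gamma$ be an inverse semigroup satisfying (LC). For $V\in\mathcal{V}(\Gamma)$ the set $S_i(V)=\{q\in\Gamma^{(0)}:V_q\subset V\}$ belongs to $\mathcal{I}(\Gamma)$. For $I\in\mathcal{I}(\Gamma)$ the set $S_u(I)=\bigcup_{q\in I}V_q$ belongs to $\mathcal{V}(\Gamma)$. The maps $S_u:\mathcal{I}(\Gamma)\to\mathcal{V}(\Gamma)$, $I\mapsto S_u(I)$, and $S_i:\mathcal{V}(\Gamma)\to\mathcal{I}(\Gamma)$, $V\mapsto S_i(V)$, are lattice isomorphisms which are inverse to each other.
   Context: In an inverse semigroup, $x\prec y$ means $xy^{-1}=xx^{-1}$ (natural partial order; $x$ is then called a precessor of $y$); $\Gamma^{(0)}$ is the set of idempotents. The symbol $0$ denotes the (unique) element $z$ with $z\prec x$ for all $x$, if it exists; conditions ''$\neq0$'' are vacuous otherwise. An element $x$ is minimal if $x\neq0$ and $y\prec x$, $y\ne0$ implies $y=x$. For $n\ge1$ write $x<(x_1,\ldots,x_n)$ if for every $y\prec x$, $y\ne0$, there exist $z\in\Gamma$, $z\neq0$, and $j$ with $z\prec y$ and $z\prec x_j$. A subset $A\subset\Gamma$ is directed if it is nonempty and any two elements of $A$ have a common $\prec$-lower bound in $A$. For directed sets write $A\prec B$ if for every $b\in B$ there is $a\in A$ with $a\prec b$, and $A\sim B$ if $A\prec B$ and $B\prec A$. $\mathcal{O}(\Gamma)$ is the set of $\sim$-classes $[A]$ of directed sets; with $[A][B]=[AB]$ and $[A]^{-1}=[A^{-1}]$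 (elementwise) it is an inverse semigroup whose natural order is $[A]\prec[B]\iff A\prec B$. For $x\in\Gamma$ write $x$ also for $[\{x\}]$. $G_u(\Gamma)$ is the groupoid with underlying set $\mathcal{O}(\Gamma)$, the inversion of $\mathcal{O}(\Gamma)$, and product $XY$ defined iff $X^{-1}X=YY^{-1}$. With $U_x=\{X:X\prec x\}$, the sets $U_x\cap U_{x_1}^c\cap\cdots\cap U_{x_n}^c$ ($x_1,\ldots,x_n\prec x$ in $\Gamma$, $n\ge0$) are a basis of the topology of $G_u(\Gamma)$. $G_m(\Gamma)$ is the subgroupoid of minimal elements of $\mathcal{O}(\Gamma)$, with the subspace topology, and $V_x=U_x\cap G_m(\Gamma)$. For a groupoid $G$, $G^{(0)}$ is its unit set, and $E\subset G^{(0)}$ is invariant if $g^{-1}g\in E$ implies $gg^{-1}\in E$ for $g\in G$. (LC): $\Gamma$ contains a zero; any $x,y\in\Gamma$ having a common precessor not equal to zero have a largest common precessor; and $G_m(\Gamma)^{(0)}$ is closed in $G_u(\Gamma)^{(0)}$. A subset $I\subset\Gamma^{(0)}$ is $<$-closed if $p\in\Gamma^{(0)}$ belongs to $I$ whenever $p<(p_1,\ldots,p_n)$ for some $p_1,\ldots,p_n\in I$; it is invariant if $xpx^{-1}\in I$ for all $p\in I$, $x\in\Gamma$ with $p\prec x^{-1}x$. For $I\subset\Gamma^{(0)}$, $\mathrm{Cl}(I)=\{p\in\Gamma^{(0)}:p<(p_1,\ldots,p_n)\text{ for some }p_1,\ldots,p_n\in I\}$. $\mathcal{I}(\Gamma)$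 is the lattice (ordered by inclusion) of $<$-closed invariant subsets of $\Gamma^{(0)}$, with $I\vee J=\mathrm{Cl}(I\cup J)$, $I\wedge J=I\cap J$. $\mathcal{V}(\Gamma)$ is the lattice (ordered by inclusion) of open invariant subsets of $G_m(\Gamma)^{(0)}$, with $U\vee V=U\cup V$, $U\wedge V=U\cap V$.
   Formalization: Members of 𝓘(Γ) are required to be nonempty: with n ≥ 1 the empty set is vacuously <-closed and invariant, and both ∅ and {0} have S_u = ∅, so S_u would not be injective. *)

(* Defs.v *)
From HB Require Import structures.
From mathcomp Require Import all_boot all_order all_algebra.
From mathcomp Require Import boolp classical_sets topology.

Set Implicit Arguments.
Unset Strict Implicit.
Unset Printing Implicit Defensive.

Import Order.TTheory.

Local Open Scope classical_set_scope.

Local Open Scope group_scope.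

HB.mixin Record Semigroup_isInverse G of Semigroup G := {
  isinv : G -> G;
  isinvK1 : forall x : G, x * isinv x * x = x;
  isinvK2 : forall x : G, isinv x * x * isinv x = isinv x;
  isinv_uniq : forall x y : G, x * y * x = x -> y * x * y = y -> y = isinv x
}.

#[short(type="inverseSemigroupType")]
HB.structure Definition InverseSemigroup :=
  {G of Semigroup_isInverse G & Semigroup G}.

Bind Scope group_scope with InverseSemigroup.sort.

(* This shadows the inverse of [baseGroupType], which requires a unit element. *)
Notation "x ^-1" := (isinv x) : group_scope.

Reserved Notation "x ≺ y" (at level 70, no associativity).

Definition natle (G : inverseSemigroupType) (x y : G) : Prop :=
  x * y^-1 = x * x^-1.
Notation "x ≺ y" := (natle x y) : group_scope.

Definition idempotents (G : semigroupType) : set G := [set e | e * e = e].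
Arguments idempotents G : clear implicits.

Definition is_zero (G : inverseSemigroupType) (z : G) : Prop :=
  forall x, z ≺ x.

(* Without a zero in [G], every element is [nonzero]. *)
Definition nonzero (G : inverseSemigroupType) (x : G) : Prop := ~ is_zero x.

Definition minimal_elements (G : inverseSemigroupType) : set G :=
  [set x | nonzero x /\ forall y, y ≺ x -> nonzero y -> y = x].
Arguments minimal_elements G : clear implicits.

(* [covered x [:: x_1; ...; x_n]] is the relation x < (x_1, ..., x_n); the    *)
(* list is required to be nonempty because this relation is only defined for  *)
(* n >= 1.                                                                    *)
Definition covered (G : inverseSemigroupType) (x : G) (s : seq G) : Prop :=
  s != [::] /\
  forall y, y ≺ x -> nonzero y ->
    exists z, [/\ nonzero z, z ≺ y & exists2 t, t \in s & z ≺ t].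

Section InverseSemigroupTheory.
Variable G : inverseSemigroupType.
Implicit Types x y z e f : G.

Local Notation mulA := (@monoid.mulgA G).

Lemma isinvK x : x^-1^-1 = x.
Proof. by apply/esym/isinv_uniq; rewrite (isinvK1, isinvK2). Qed.

Lemma isinv_idem e : idempotents G e -> e^-1 = e.
Proof. by move=> ee; apply/esym/isinv_uniq; rewrite ee. Qed.

Lemma idemM e f : idempotents G e -> idempotents G f ->
  idempotents G (e * f).
Proof.
move=> ee ff; pose u := (e * f)^-1.
have fue : f * u * e = u.
  apply: isinv_uniq.
    transitivity (e * f * u * (e * f)); last exact: isinvK1.
    by rewrite -!mulA (mulA f f) ff (mulA e e) ee.
  have -> : f * u * e * (e * f) * (f * u * e) = f * (u * (e * f) * u) * e.
    by rewrite -!mulA (mulA f f) ff (mulA e e) ee.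
  by rewrite isinvK2.
have uu : idempotents G u.
  rewrite /idempotents /=.
  transitivity (f * u * e * (f * u * e)); first by rewrite fue.
  have -> : f * u * e * (f * u * e) = f * (u * (e * f) * u) * e.
    by rewrite -!mulA.
  by rewrite isinvK2.
by rewrite -(isinvK (e * f)) (isinv_idem uu).
Qed.

Lemma idemC e f : idempotents G e -> idempotents G f -> e * f = f * e.
Proof.
move=> ee ff; have ef := idemM ee ff; have fe := idemM ff ee.
rewrite -[LHS](isinv_idem ef); apply/esym/isinv_uniq.
  transitivity (e * f * (e * f)); last exact: ef.
  by rewrite -!mulA (mulA f f) ff (mulA e e) ee.
transitivity (f * e * (f * e)); last exact: fe.
by rewrite -!mulA (mulA e e) ee (mulA f f) ff.
Qed.

Lemma idem_mulV x : idempotents G (x * x^-1).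
Proof. by rewrite /idempotents /= mulA isinvK1. Qed.

Lemma idem_Vmul x : idempotents G (x^-1 * x).
Proof. by rewrite /idempotents /= mulA isinvK2. Qed.

Lemma isinvM x y : (x * y)^-1 = y^-1 * x^-1.
Proof.
apply/esym/isinv_uniq.
  have -> : x * y * (y^-1 * x^-1) * (x * y) = x * (y * y^-1 * (x^-1 * x)) * y.
    by rewrite !mulA.
  rewrite (idemC (idem_mulV y) (idem_Vmul x)).
  have -> : x * (x^-1 * x * (y * y^-1)) * y = x * x^-1 * x * (y * y^-1 * y).
    by rewrite !mulA.
  by rewrite !isinvK1.
have -> : y^-1 * x^-1 * (x * y) * (y^-1 * x^-1) =
    y^-1 * (x^-1 * x * (y * y^-1)) * x^-1 by rewrite !mulA.
rewrite -(idemC (idem_mulV y) (idem_Vmul x)).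
have -> : y^-1 * (y * y^-1 * (x^-1 * x)) * x^-1 =
    y^-1 * y * y^-1 * (x^-1 * x * x^-1) by rewrite !mulA.
by rewrite !isinvK2.
Qed.

Lemma natleP x y : x ≺ y <-> exists2 e, idempotents G e & x = e * y.
Proof.
split.
  move=> xy; exists (y * (x^-1 * x) * y^-1).
    rewrite /idempotents /=.
    have -> : y * (x^-1 * x) * y^-1 * (y * (x^-1 * x) * y^-1) =
        y * ((x^-1 * x) * (y^-1 * y)) * (x^-1 * x) * y^-1 by rewrite !mulA.
    rewrite (idemC (idem_Vmul x) (idem_Vmul y)).
    have -> : y * (y^-1 * y * (x^-1 * x)) * (x^-1 * x) * y^-1 =
        y * y^-1 * y * (x^-1 * x * (x^-1 * x)) * y^-1 by rewrite !mulA.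
    by rewrite isinvK1 idem_Vmul.
  have := congr1 (@isinv G) xy; rewrite !isinvM !isinvK => yx.
  have -> : y * (x^-1 * x) * y^-1 * y = y * (x^-1 * x * (y^-1 * y)).
    by rewrite !mulA.
  rewrite (idemC (idem_Vmul x) (idem_Vmul y)).
  have -> : y * (y^-1 * y * (x^-1 * x)) = y * y^-1 * y * x^-1 * x.
    by rewrite !mulA.
  by rewrite isinvK1 yx isinvK1.
move=> [e ee ->]; rewrite /natle isinvM (isinv_idem ee).
have -> : e * y * (y^-1 * e) = e * (y * y^-1 * e) by rewrite !mulA.
by rewrite (idemC (idem_mulV y) ee) mulA ee mulA.
Qed.

Lemma natle_mull e y : idempotents G e -> e * y ≺ y.
Proof. by move=> ee; apply/natleP; exists e. Qed.

Lemma natlePr x y : x ≺ y <-> exists2 e, idempotents G e & x = y * e.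
Proof.
split=> [/natleP|] [e ee ->].
  exists (y^-1 * e * y).
    rewrite /idempotents /=.
    have -> : y^-1 * e * y * (y^-1 * e * y) = y^-1 * e * (y * y^-1 * e) * y.
      by rewrite !mulA.
    rewrite (idemC (idem_mulV y) ee).
    have -> : y^-1 * e * (e * (y * y^-1)) * y = y^-1 * (e * e) * (y * y^-1 * y).
      by rewrite !mulA.
    by rewrite ee isinvK1.
  have -> : y * (y^-1 * e * y) = y * y^-1 * e * y by rewrite !mulA.
  by rewrite (idemC (idem_mulV y) ee) -mulA isinvK1.
apply/natleP; exists (y * e * y^-1).
  rewrite /idempotents /=.
  have -> : y * e * y^-1 * (y * e * y^-1) = y * (e * (y^-1 * y)) * e * y^-1.
    by rewrite !mulA.
  rewrite (idemC ee (idem_Vmul y)).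
  have -> : y * (y^-1 * y * e) * e * y^-1 = y * y^-1 * y * (e * e) * y^-1.
    by rewrite !mulA.
  by rewrite isinvK1 ee.
have -> : y * e * y^-1 * y = y * (e * (y^-1 * y)) by rewrite !mulA.
rewrite (idemC ee (idem_Vmul y)).
have -> : y * (y^-1 * y * e) = y * y^-1 * y * e by rewrite !mulA.
by rewrite isinvK1.
Qed.

Lemma natle_mulr e y : idempotents G e -> y * e ≺ y.
Proof. by move=> ee; apply/natlePr; exists e. Qed.

Lemma natle_refl x : x ≺ x.
Proof. by []. Qed.

Lemma natle_trans y x z : x ≺ y -> y ≺ z -> x ≺ z.
Proof.
move=> /natleP[e ee ->] /natleP[f ff ->]; rewrite mulA.
exact/natle_mull/idemM.
Qed.

Lemma natle_lE x y : x ≺ y -> x = x * x^-1 * y.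
Proof.
move=> /natleP[e ee ->]; rewrite isinvM (isinv_idem ee).
have -> : e * y * (y^-1 * e) * y = e * (y * y^-1 * e) * y by rewrite !mulA.
rewrite (idemC (idem_mulV y) ee).
have -> : e * (e * (y * y^-1)) * y = (e * e) * (y * y^-1 * y) by rewrite !mulA.
by rewrite ee isinvK1.
Qed.

Lemma natle_rE x y : x ≺ y -> x = y * (x^-1 * x).
Proof.
move=> /natlePr[e ee ->]; rewrite isinvM (isinv_idem ee).
have -> : y * (e * y^-1 * (y * e)) = y * (e * (y^-1 * y)) * e by rewrite !mulA.
rewrite (idemC ee (idem_Vmul y)).
have -> : y * (y^-1 * y * e) * e = y * y^-1 * y * (e * e) by rewrite !mulA.
by rewrite ee isinvK1.
Qed.

Lemma natle_anti x y : x ≺ y -> y ≺ x -> x = y.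
Proof.
move=> xy yx; rewrite {1}(natle_lE xy) {1}(natle_lE yx) (mulA (x * _)).
by rewrite (idemC (idem_mulV x) (idem_mulV y)) -(mulA (y * _)) isinvK1
  -(natle_lE yx).
Qed.

Lemma natleM x x' y y' : x ≺ x' -> y ≺ y' -> x * y ≺ x' * y'.
Proof.
move=> /natleP[e ee ->] /natlePr[f ff ->].
have -> : e * x' * (y' * f) = e * (x' * y') * f by rewrite !mulA.
exact: (natle_trans (natle_mulr _ ff) (natle_mull _ ee)).
Qed.

Lemma natleV x y : x ≺ y -> x^-1 ≺ y^-1.
Proof.
move=> /natleP[e ee ->]; rewrite isinvM (isinv_idem ee); exact: natle_mulr.
Qed.

Lemma idem_natle x e : idempotents G e -> x ≺ e -> idempotents G x.
Proof. by move=> ee /natleP[f ff ->]; apply: idemM. Qed.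

Lemma idem_conj x e : idempotents G e -> idempotents G (x * e * x^-1).
Proof.
move=> ee; rewrite /idempotents /=.
have -> : x * e * x^-1 * (x * e * x^-1) = x * (e * (x^-1 * x)) * e * x^-1.
  by rewrite !mulA.
rewrite (idemC ee (idem_Vmul x)).
have -> : x * (x^-1 * x * e) * e * x^-1 = x * x^-1 * x * (e * e) * x^-1.
  by rewrite !mulA.
by rewrite isinvK1 ee.
Qed.

Lemma idem_conjV x e : idempotents G e -> idempotents G (x^-1 * e * x).
Proof. by move=> ee; rewrite -{2}(isinvK x); apply: idem_conj. Qed.

Lemma is_zero_natle x z : is_zero z -> x ≺ z -> is_zero x.
Proof. by move=> z0 xz y; apply: natle_trans xz (z0 y). Qed.

Lemma is_zero_uniq z z' : is_zero z -> is_zero z' -> z = z'.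
Proof. by move=> h h'; apply: natle_anti. Qed.

Lemma nonzero_natle x y : x ≺ y -> nonzero x -> nonzero y.
Proof. by move=> xy + y0; apply; apply: is_zero_natle y0 xy. Qed.

Lemma is_zero_idem z : is_zero z -> idempotents G z.
Proof. by move=> z0; apply: idem_natle (idem_mulV z) (z0 _). Qed.

Lemma is_zero_mull x z : is_zero z -> x * z = z.
Proof.
move=> z0; have zi := is_zero_idem z0.
by rewrite [RHS](natle_rE (z0 x)) (isinv_idem zi) zi.
Qed.

Lemma is_zero_mulr x z : is_zero z -> z * x = z.
Proof.
move=> z0; have zi := is_zero_idem z0.
by rewrite [RHS](natle_lE (z0 x)) (isinv_idem zi) zi.
Qed.

Lemma is_zeroV z : is_zero z -> is_zero z^-1.
Proof. by move=> z0; rewrite (isinv_idem (is_zero_idem z0)). Qed.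

End InverseSemigroupTheory.

Lemma inverse_uniq_of_idemC (S : semigroupType) :
  (forall e f : S, idempotents S e -> idempotents S f -> e * f = f * e) ->
  forall x y z : S, x * y * x = x -> y * x * y = y ->
    x * z * x = x -> z * x * z = z -> y = z.
Proof.
move=> idC x y z xyx yxy xzx zxz.
have xyi : idempotents S (x * y) by rewrite /idempotents /= monoid.mulgA xyx.
have xzi : idempotents S (x * z) by rewrite /idempotents /= monoid.mulgA xzx.
have yxi : idempotents S (y * x) by rewrite /idempotents /= monoid.mulgA yxy.
have zxi : idempotents S (z * x) by rewrite /idempotents /= monoid.mulgA zxz.
have -> : y = y * (x * z).
  transitivity (y * ((x * z) * (x * y))).
    by rewrite (monoid.mulgA (x * z)) xzx monoid.mulgA yxy.
  by rewrite (idC _ _ xzi xyi) !monoid.mulgA yxy.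
transitivity ((z * x) * (y * x) * z); last first.
  have -> : z * x * (y * x) * z = z * (x * y * x) * z.
    by rewrite !monoid.mulgA.
  by rewrite xyx zxz.
rewrite (idC _ _ zxi yxi) -!monoid.mulgA; congr (y * (x * _)).
by rewrite monoid.mulgA zxz.
Qed.

(* A groupoid as a set with a partial multiplication: [gmul g h] is only      *)
(* meaningful when [gcomp g h] holds.                                         *)
Record groupoid (T : Type) := Groupoid {
  gset : set T;
  gcomp : T -> T -> Prop;
  gmul : T -> T -> T;
  ginv : T -> T;
  gset_mul : forall g h, gset g -> gset h -> gcomp g h -> gset (gmul g h);
  gset_inv : forall g, gset g -> gset (ginv g);
  ginvK : forall g, gset g -> ginv (ginv g) = g;
  gcompA : forall g h k, gset g -> gset h -> gset k ->
    gcomp g h -> gcomp h k ->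
    [/\ gcomp (gmul g h) k, gcomp g (gmul h k)
      & gmul (gmul g h) k = gmul g (gmul h k)];
  gcompV : forall g, gset g -> gcomp (ginv g) g;
  gmulVK : forall g h, gset g -> gset h -> gcomp g h ->
    gmul (ginv g) (gmul g h) = h;
  gmulKV : forall g h, gset g -> gset h -> gcomp g h ->
    gmul (gmul g h) (ginv h) = g
}.

Definition gunits (T : Type) (G : groupoid T) : set T :=
  [set gmul G g (ginv G g) | g in gset G].

Definition ginvariant (T : Type) (G : groupoid T) (E : set T) : Prop :=
  E `<=` gunits G /\
  forall g, gset G g -> E (gmul G (ginv G g) g) -> E (gmul G g (ginv G g)).

Section RestrictedProduct.
Variable S : inverseSemigroupType.
Implicit Types x y z : S.

Definition rcomp x y : Prop := x^-1 * x = y * y^-1.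

Let rcompA x y z : rcomp x y -> rcomp y z ->
  [/\ rcomp (x * y) z, rcomp x (y * z) & x * y * z = x * (y * z)].
Proof.
rewrite /rcomp => xy yz; split; last by rewrite monoid.mulgA.
  rewrite isinvM -yz.
  have -> : y^-1 * x^-1 * (x * y) = y^-1 * (x^-1 * x) * y.
    by rewrite !monoid.mulgA.
  by rewrite xy !monoid.mulgA isinvK2.
rewrite isinvM xy.
have -> : y * z * (z^-1 * y^-1) = y * (z * z^-1) * y^-1.
  by rewrite !monoid.mulgA.
by rewrite -yz !monoid.mulgA isinvK1.
Qed.

Let rcompV x : rcomp x^-1 x.
Proof. by rewrite /rcomp isinvK. Qed.

Let rmulVK x y : rcomp x y -> x^-1 * (x * y) = y.
Proof. by rewrite /rcomp monoid.mulgA => ->; rewrite isinvK1. Qed.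

Let rmulKV x y : rcomp x y -> x * y * y^-1 = x.
Proof. by rewrite /rcomp -monoid.mulgA => <-; rewrite monoid.mulgA isinvK1. Qed.

Definition restricted_groupoid : groupoid S :=
  @Groupoid S setT rcomp (fun x y => x * y) (@isinv S)
    (fun _ _ _ _ _ => I) (fun _ _ => I) (fun x _ => isinvK x)
    (fun x y z _ _ _ => @rcompA x y z) (fun x _ => rcompV x)
    (fun x y _ _ => @rmulVK x y) (fun x y _ _ => @rmulKV x y).

Let minimal_inv x : minimal_elements S x -> minimal_elements S x^-1.
Proof.
move=> [x0 xmin]; split; first by move/is_zeroV; rewrite isinvK.
move=> y /natleV; rewrite isinvK => yx y0.
by rewrite -(xmin _ yx) ?isinvK // => /is_zeroV; rewrite isinvK.
Qed.

Let minimal_mul x y : minimal_elements S x -> minimal_elements S y ->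
  rcomp x y -> minimal_elements S (x * y).
Proof.
move=> [x0 xmin] _ xy; split.
  by move=> xy0; apply: x0; rewrite -(rmulKV xy) (is_zero_mulr _ xy0).
move=> z zxy z0; have zE := natle_lE zxy; rewrite monoid.mulgA in zE.
have zx : z * z^-1 * x ≺ x by apply/natle_mull/idem_mulV.
rewrite zE (xmin _ zx) // => zx0; apply: z0.
by rewrite zE (is_zero_mulr _ zx0).
Qed.

Definition minimal_groupoid : groupoid S :=
  @Groupoid S (minimal_elements S) rcomp (fun x y => x * y) (@isinv S)
    minimal_mul minimal_inv (fun x _ => isinvK x)
    (fun x y z _ _ _ => @rcompA x y z) (fun x _ => rcompV x)
    (fun x y _ _ => @rmulVK x y) (fun x y _ _ => @rmulKV x y).

End RestrictedProduct.

Section DirectedSets.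
Variable Γ : inverseSemigroupType.
Implicit Types (x y : Γ).

Definition directed (A : set Γ) : Prop :=
  A !=set0 /\ forall a b, A a -> A b -> exists2 c, A c & c ≺ a /\ c ≺ b.

Record dirset := Dirset { dset :> Γ -> Prop; dsetP : directed dset }.

HB.instance Definition _ := gen_eqMixin dirset.
HB.instance Definition _ := gen_choiceMixin dirset.

Implicit Types A B C : dirset.

Definition dle A B : Prop := forall b, B b -> exists2 a, A a & a ≺ b.

Definition dequiv A B : bool := `[< dle A B /\ dle B A >].

Lemma dle_refl A : dle A A.
Proof. by move=> a Aa; exists a => //; apply: natle_refl. Qed.

Lemma dle_trans B A C : dle A B -> dle B C -> dle A C.
Proof.
move=> AB BC c /BC[b /AB[a Aa ab] bc]; exists a => //.
exact: natle_trans ab bc.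
Qed.

Lemma dequiv_refl : reflexive dequiv.
Proof. by move=> A; apply/asboolP; split; apply: dle_refl. Qed.

Lemma dequiv_sym : symmetric dequiv.
Proof. by move=> A B; apply/asboolP/asboolP => -[]. Qed.

Lemma dequiv_trans : transitive dequiv.
Proof.
move=> B A C /asboolP[AB BA] /asboolP[BC CB]; apply/asboolP.
by split; [apply: dle_trans AB BC | apply: dle_trans CB BA].
Qed.

Canonical dequiv_equiv := EquivRel dequiv dequiv_refl dequiv_sym dequiv_trans.

Lemma dmul_directed A B : directed [set a * b | a in dset A & b in dset B].
Proof.
have [[a Aa] dA] := dsetP A; have [[b Bb] dB] := dsetP B; split.
  by exists (a * b); exists a => //; exists b.
move=> _ _ [a1 Aa1 [b1 Bb1 <-]] [a2 Aa2 [b2 Bb2 <-]].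
have [a3 Aa3 [a31 a32]] := dA _ _ Aa1 Aa2.
have [b3 Bb3 [b31 b32]] := dB _ _ Bb1 Bb2.
by exists (a3 * b3); [exists a3 => //; exists b3 | split; apply: natleM].
Qed.

Definition dmul A B : dirset := Dirset (dmul_directed A B).

Lemma dinv_directed A : directed [set a^-1 | a in dset A].
Proof.
have [[a Aa] dA] := dsetP A; split; first by exists a^-1; exists a.
move=> _ _ [a1 Aa1 <-] [a2 Aa2 <-].
have [a3 Aa3 [a31 a32]] := dA _ _ Aa1 Aa2.
by exists a3^-1; [exists a3 | split; apply: natleV].
Qed.

Definition dinv A : dirset := Dirset (dinv_directed A).

Lemma dsingle_directed x : directed [set x].
Proof.
by split=> [|_ _ -> ->]; exists x => //; split; apply: natle_refl.
Qed.

Definition dsingle x : dirset := Dirset (dsingle_directed x).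

Lemma dleM A A' B B' : dle A A' -> dle B B' -> dle (dmul A B) (dmul A' B').
Proof.
move=> AA BB _ [a' /AA[a Aa aa'] [b' /BB[b Bb bb'] <-]].
by exists (a * b); [exists a => //; exists b | apply: natleM].
Qed.

Lemma dleV A A' : dle A A' -> dle (dinv A) (dinv A').
Proof.
move=> AA _ [a' /AA[a Aa aa'] <-].
by exists a^-1; [exists a | apply: natleV].
Qed.

Lemma dirset_eq A B : dset A = dset B -> A = B.
Proof.
case: A B => [A dA] [B dB] /= eAB; subst B.
by congr Dirset; apply: Prop_irrelevance.
Qed.

Lemma dmulA A B C : dmul A (dmul B C) = dmul (dmul A B) C.
Proof.
apply: dirset_eq; apply/seteqP; split=> x /=.
  move=> [a Aa [_ [b Bb [c Cc <-]] <-]]; exists (a * b).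
    by exists a => //; exists b.
  by exists c; rewrite ?monoid.mulgA.
move=> [_ [a Aa [b Bb <-]] [c Cc <-]]; exists a => //; exists (b * c).
  by exists b => //; exists c.
by rewrite monoid.mulgA.
Qed.

Lemma dmulVK A : dequiv (dmul (dmul A (dinv A)) A) A.
Proof.
apply/asboolP; split=> [a Aa|].
  exists (a * a^-1 * a); last by rewrite isinvK1; apply: natle_refl.
  exists (a * a^-1); last by exists a.
  by exists a => //; exists a^-1 => //; exists a.
move=> _ [_ [a Aa [_ [b Ab <-] <-]] [c Ac <-]].
have [_ dA] := dsetP A.
have [d Ad [da db]] := dA _ _ Aa Ab; have [e Ae [ed ec]] := dA _ _ Ad Ac.
exists e => //; rewrite -(isinvK1 e); apply: natleM => //.
by apply: natleM; [|apply: natleV]; apply: natle_trans ed _.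
Qed.

Lemma dinvK A : dinv (dinv A) = A.
Proof.
apply: dirset_eq; apply/seteqP; split=> a /=.
  by move=> [_ [b Ab <-] <-]; rewrite isinvK.
by move=> Aa; exists a^-1; [exists a | rewrite isinvK].
Qed.

Lemma dmul_idem A : dequiv (dmul A A) A ->
  forall a, A a -> exists c, [/\ A c, idempotents Γ c & c ≺ a].
Proof.
move=> /asboolP[_ AAA] a Aa; have [_ dA] := dsetP A.
have [|d Ad daa] := AAA (a * a); first by exists a => //; exists a.
have [c Ac [cd ca]] := dA _ _ Ad Aa; exists c; split=> //.
have caa := natle_trans cd daa.
have cE : c = c * a.
  by rewrite {1}(natle_lE caa) monoid.mulgA -(natle_lE ca).
have fE : c^-1 * c = c^-1 * c * a by rewrite -monoid.mulgA -cE.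
have fa : c^-1 * c ≺ a.
  by apply/natleP; exists (c^-1 * c) => //; apply: idem_Vmul.
have := natle_rE fa; rewrite (isinv_idem (idem_Vmul c)) idem_Vmul => faE.
by rewrite (natle_rE ca) -faE; apply: idem_Vmul.
Qed.

Lemma dmulC_idem A B : dequiv (dmul A A) A -> dequiv (dmul B B) B ->
  dle (dmul A B) (dmul B A).
Proof.
move=> iA iB _ [b Bb [a Aa <-]].
have [c [Ac ci ca]] := dmul_idem iA Aa; have [d [Bd di db]] := dmul_idem iB Bb.
exists (c * d); first by exists c => //; exists d.
by rewrite (idemC ci di); apply: natleM.
Qed.

End DirectedSets.

(* 𝒪(Γ); its natural order is computed on representatives by                  *)
(* [dirclass_natle] below.                                                    *)
Definition dirclass (Γ : inverseSemigroupType) : Type :=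
  {eq_quot (@dequiv_equiv Γ)}%qT.

HB.instance Definition _ Γ := Choice.on (dirclass Γ).
HB.instance Definition _ Γ := EqQuotient.on (dirclass Γ).

Section DirectedClasses.
Variable Γ : inverseSemigroupType.
Local Open Scope quotient_scope.
Local Notation O := (dirclass Γ).
Implicit Types (A B C : dirset Γ) (X Y Z : O).

Definition dirclass_of A : O := \pi_O A.

Lemma dirclassW (P : O -> Prop) : (forall A, P (dirclass_of A)) -> forall X, P X.
Proof. by move=> h X; rewrite -[X]reprK; apply: h. Qed.

Lemma dequivP A B : reflect (dirclass_of A = dirclass_of B) (dequiv A B).
Proof. exact: eqmodP. Qed.

Lemma dirclass_ofP A B :
  dirclass_of A = dirclass_of B <-> dle A B /\ dle B A.
Proof. by split=> [/dequivP/asboolP|/asboolP/dequivP]. Qed.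

Definition dirclass_mul X Y : O := dirclass_of (dmul (repr X) (repr Y)).
Definition dirclass_inv X : O := dirclass_of (dinv (repr X)).

Lemma dirclass_mulE A B :
  dirclass_mul (dirclass_of A) (dirclass_of B) = dirclass_of (dmul A B).
Proof.
have /dirclass_ofP[AA' A'A] := reprK (dirclass_of A).
have /dirclass_ofP[BB' B'B] := reprK (dirclass_of B).
by apply/dirclass_ofP; split; apply: dleM.
Qed.

Lemma dirclass_invE A : dirclass_inv (dirclass_of A) = dirclass_of (dinv A).
Proof.
have /dirclass_ofP[AA' A'A] := reprK (dirclass_of A).
by apply/dirclass_ofP; split; apply: dleV.
Qed.

Lemma dirclass_mulA : associative dirclass_mul.
Proof.
elim/dirclassW=> A; elim/dirclassW=> B; elim/dirclassW=> C.
rewrite (dirclass_mulE B C) (dirclass_mulE A B).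
by rewrite (dirclass_mulE A (dmul B C)) (dirclass_mulE (dmul A B) C) dmulA.
Qed.

HB.instance Definition _ := isSemigroup.Build O dirclass_mulA.

Lemma dirclass_ofM A B :
  dirclass_of (dmul A B) = dirclass_of A * dirclass_of B.
Proof. exact/esym/dirclass_mulE. Qed.

Lemma dirclass_invK1 X : X * dirclass_inv X * X = X.
Proof.
elim/dirclassW: X => A; rewrite dirclass_invE -(dirclass_ofM A) -dirclass_ofM.
exact/dequivP/dmulVK.
Qed.

Lemma dirclass_invK2 X : dirclass_inv X * X * dirclass_inv X = dirclass_inv X.
Proof.
elim/dirclassW: X => A; rewrite dirclass_invE -(dirclass_ofM _ A) -dirclass_ofM.
by have /dequivP := dmulVK (dinv A); rewrite dinvK.
Qed.

Lemma dirclass_idemC X Y : idempotents O X -> idempotents O Y -> X * Y = Y * X.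
Proof.
elim/dirclassW: X => A; elim/dirclassW: Y => B; rewrite /idempotents /=.
rewrite -!dirclass_ofM => /dequivP iA /dequivP iB.
by apply/dirclass_ofP; split; apply: dmulC_idem.
Qed.

Lemma dirclass_inv_uniq X Y : X * Y * X = X -> Y * X * Y = Y ->
  Y = dirclass_inv X.
Proof.
move=> h1 h2; apply: (inverse_uniq_of_idemC dirclass_idemC h1 h2).
  exact: dirclass_invK1.
exact: dirclass_invK2.
Qed.

HB.instance Definition _ := Semigroup_isInverse.Build O
  dirclass_invK1 dirclass_invK2 dirclass_inv_uniq.

Lemma dirclass_ofV A : dirclass_of (dinv A) = (dirclass_of A)^-1.
Proof. exact/esym/dirclass_invE. Qed.

Lemma dirclass_natle A B : (dirclass_of A ≺ dirclass_of B) <-> dle A B.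
Proof.
have [[a0 Aa0] dA] := dsetP A; split=> [h|AB].
  have := natle_lE h; rewrite -dirclass_ofV -(dirclass_ofM A) -dirclass_ofM.
  move=> /dirclass_ofP[+ _] b Bb => /(_ (a0 * a0^-1 * b)) [|a Aa ab].
    rewrite /=; exists (a0 * a0^-1); last by exists b.
    by exists a0 => //; exists a0^-1 => //; exists a0.
  by exists a => //; apply: natle_trans ab _; apply/natle_mull/idem_mulV.
have -> : dirclass_of A = dirclass_of A * (dirclass_of A)^-1 * dirclass_of B.
  rewrite -dirclass_ofV -(dirclass_ofM A) -dirclass_ofM.
  apply/dirclass_ofP; split.
    have /asboolP[_ h] := dmulVK A; apply: dle_trans h _.
    by apply: dleM => //; apply: dle_refl.
  move=> a Aa; have [[b Bb] _] := dsetP B; have [a' Aa' a'b] := AB _ Bb.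
  have [c Ac [ca ca']] := dA _ _ Aa Aa'.
  exists (c * c^-1 * b).
    rewrite /=; exists (c * c^-1); last by exists b.
    by exists c => //; exists c^-1 => //; exists c.
  by rewrite -(natle_lE (natle_trans ca' a'b)).
exact/natle_mull/idem_mulV.
Qed.

Definition principal (x : Γ) : O := dirclass_of (dsingle x).

Lemma principalM x y : principal (x * y) = principal x * principal y.
Proof.
rewrite /principal -dirclass_ofM; congr dirclass_of.
apply: dirset_eq; apply/seteqP; split=> z /=.
  by move=> ->; exists x => //; exists y.
by move=> [_ -> [_ -> <-]].
Qed.

Lemma principalV x : principal x^-1 = (principal x)^-1.
Proof.
rewrite /principal -dirclass_ofV; congr dirclass_of.
apply: dirset_eq; apply/seteqP; split=> z /=; first by move=> ->; exists x.
by move=> [_ -> <-].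
Qed.

Lemma principal_natle x y : (principal x ≺ principal y) <-> x ≺ y.
Proof.
split=> [/dirclass_natle/(_ y erefl)[_ ->] //|xy].
by apply/dirclass_natle => _ ->; exists x.
Qed.

End DirectedClasses.

Definition Gu (Γ : inverseSemigroupType) : groupoid (dirclass Γ) :=
  restricted_groupoid (dirclass Γ).

Definition Gm (Γ : inverseSemigroupType) : groupoid (dirclass Γ) :=
  minimal_groupoid (dirclass Γ).

Definition Uset (Γ : inverseSemigroupType) (x : Γ) : set (dirclass Γ) :=
  [set X | X ≺ principal x].

Definition Vset (Γ : inverseSemigroupType) (x : Γ) : set (dirclass Γ) :=
  Uset x `&` gset (Gm Γ).

(* The topology put on 𝒪(Γ) here is the one of G_u(Γ). *)
Section Topology.
Variable Γ : inverseSemigroupType.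

Definition Gu_basis : set (set (dirclass Γ)) :=
  [set B | exists x (s : seq Γ), (forall y, y \in s -> y ≺ x) /\
     B = Uset x `&` \bigcap_(y in [set` s]) ~` Uset y].

Lemma Gu_basis_cover : \bigcup_(B in Gu_basis) B = setT.
Proof.
apply/seteqP; split=> // + _; elim/dirclassW=> A; have [[a Aa] _] := dsetP A.
exists (Uset a `&` \bigcap_(y in [set` [::]]) ~` Uset y).
  by exists a, [::].
split; last by [].
by apply/dirclass_natle => _ ->; exists a => //; apply: natle_refl.
Qed.

Lemma Gu_basis_join (B1 B2 : set (dirclass Γ)) (X : dirclass Γ) :
  Gu_basis B1 -> Gu_basis B2 -> B1 X -> B2 X ->
  exists B3, [/\ Gu_basis B3, B3 X & B3 `<=` B1 `&` B2].
Proof.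
move=> [x1 [s1 [s1x1 ->]]] [x2 [s2 [s2x2 ->]]] [Xx1 Xs1] [Xx2 Xs2].
have [c [cx1 cx2 Xc]] : exists c, [/\ c ≺ x1, c ≺ x2 & Uset c X].
  elim/dirclassW: X Xx1 Xx2 {Xs1 Xs2} => A.
  move=> /dirclass_natle/(_ x1 erefl)[a1 Aa1 a1x1].
  move=> /dirclass_natle/(_ x2 erefl)[a2 Aa2 a2x2].
  have [_ dA] := dsetP A; have [c Ac [ca1 ca2]] := dA _ _ Aa1 Aa2.
  exists c; split; [exact: natle_trans ca1 _|exact: natle_trans ca2 _|].
  by apply/dirclass_natle => _ ->; exists c => //; apply: natle_refl.
pose m y := c * c^-1 * y.
have my y : m y ≺ y by apply/natle_mull/idem_mulV.
have mc x y : c ≺ x -> y ≺ x -> m y ≺ c.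
  move=> cx yx; rewrite /m (natle_lE yx) monoid.mulgA.
  rewrite (idemC (idem_mulV c) (idem_mulV y)) -monoid.mulgA -(natle_lE cx).
  exact/natle_mull/idem_mulV.
have mU y Y : Uset c Y -> Uset y Y -> Uset (m y) Y.
  rewrite /Uset /= /m !principalM principalV => Yc Yy.
  by rewrite -(isinvK1 Y); apply: natleM => //; apply: natleM => //;
    apply: natleV.
exists (Uset c `&` \bigcap_(y in [set` map m (s1 ++ s2)]) ~` Uset y); split.
- exists c, (map m (s1 ++ s2)); split=> // _ /mapP[y + ->].
  rewrite mem_cat => /orP[ys|ys]; first exact: mc cx1 (s1x1 _ ys).
  exact: mc cx2 (s2x2 _ ys).
- split=> // _ /= /mapP[y + ->] Xmy; rewrite mem_cat => /orP[] ys.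
    by apply: (Xs1 _ ys); apply: natle_trans Xmy _; apply/principal_natle.
  by apply: (Xs2 _ ys); apply: natle_trans Xmy _; apply/principal_natle.
- move=> Y [Yc Ys]; split; (split=> [|y ys Yy]).
  + by apply: natle_trans Yc _; apply/principal_natle.
  + apply: (Ys (m y)); last exact: mU.
    by apply: map_f; rewrite mem_cat ys.
  + by apply: natle_trans Yc _; apply/principal_natle.
  + apply: (Ys (m y)); last exact: mU.
    by apply: map_f; rewrite mem_cat ys orbT.
Qed.

HB.instance Definition _ := isBaseTopological.Build (dirclass Γ)
  Gu_basis_cover Gu_basis_join.

End Topology.

Definition LC (Γ : inverseSemigroupType) : Prop :=
  [/\ exists z : Γ, is_zero z,
      forall x y : Γ, (exists z, [/\ nonzero z, z ≺ x & z ≺ y]) ->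
        exists m, [/\ m ≺ x, m ≺ y & forall w, w ≺ x -> w ≺ y -> w ≺ m]
    & closed (gunits (Gm Γ) : set (subspace (gunits (Gu Γ))))].

Definition lt_closed (Γ : inverseSemigroupType) (I : set Γ) : Prop :=
  forall p s, idempotents Γ p -> (forall q, q \in s -> I q) ->
    covered p s -> I p.

Definition conj_invariant (Γ : inverseSemigroupType) (I : set Γ) : Prop :=
  forall p x, I p -> p ≺ x^-1 * x -> I (x * p * x^-1).

Definition Cl (Γ : inverseSemigroupType) (I : set Γ) : set Γ :=
  [set p | idempotents Γ p /\
     exists2 s, (forall q, q \in s -> I q) & covered p s].

(* The empty set satisfies the other three conditions, because [covered]      *)
(* requires a nonempty list. When Γ has a zero, requiring [I !=set0] amounts  *)
(* to requiring 0 ∈ I; otherwise ∅ and {0} would both belong to 𝓘(Γ) and have *)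
(* the same image ∅ under [Su].                                              *)
Definition calI (Γ : inverseSemigroupType) : set (set Γ) :=
  [set I | [/\ I `<=` idempotents Γ, I !=set0, lt_closed I
             & conj_invariant I]].

Definition calV (Γ : inverseSemigroupType) : set (set (dirclass Γ)) :=
  [set V | open (V : set (subspace (gunits (Gm Γ)))) /\ ginvariant (Gm Γ) V].

Arguments calI Γ : clear implicits.
Arguments calV Γ : clear implicits.

Section LatticeI.
Variable Γ : inverseSemigroupType.
Implicit Types (I J K : set Γ) (p q x y e f g : Γ).

Lemma covered_natle p q : p ≺ q -> covered p [:: q].
Proof.
move=> pq; split=> // y yp y0; exists y; split=> //.
by exists q; [rewrite inE | apply: natle_trans yp pq].
Qed.

Lemma sub_Cl I : I `<=` idempotents Γ -> I `<=` Cl I.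
Proof.
move=> Ii p Ip; split; first exact: Ii.
by exists [:: p]; [move=> q; rewrite inE => /eqP -> |
  apply/covered_natle/natle_refl].
Qed.

Lemma Cl_lt_closed I : lt_closed (Cl I).
Proof.
move=> p s pi sI [s0 ps]; split=> //.
have [t tI tP] : exists2 t : seq Γ, (forall q, q \in t -> I q) &
    t != [::] /\ forall q y, q \in s -> y ≺ q -> nonzero y ->
      exists z, [/\ nonzero z, z ≺ y & exists2 r, r \in t & z ≺ r].
  elim: s s0 sI {ps} => // q s IHs _ sI.
  have [|qi [tq tqI [tq0 tqP]]] := sI q; first by rewrite inE eqxx.
  have [->|s0] := eqVneq s [::].
    exists tq => //; split=> // r y; rewrite inE => /eqP ->; exact: tqP.
  have [|t tI [t0 tP]] := IHs s0.
    by move=> r rs; apply: sI; rewrite inE rs orbT.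
  exists (tq ++ t) => [r|].
    by rewrite mem_cat => /orP[/tqI|/tI].
  split; first by case: (tq) tq0.
  move=> r y; rewrite inE => /orP[/eqP ->|rs] yr y0.
    have [z [z0 zy [u ut zu]]] := tqP _ yr y0.
    by exists z; split=> //; exists u => //; rewrite mem_cat ut.
  have [z [z0 zy [u ut zu]]] := tP _ _ rs yr y0.
  by exists z; split=> //; exists u => //; rewrite mem_cat ut orbT.
exists t => //; split; first by have [] := tP.
move=> y yp y0; have [z [z0 zy [q qs zq]]] := ps _ yp y0.
have [_ /(_ _ _ qs zq z0)[w [w0 wz ?]]] := tP.
by exists w; split=> //; apply: natle_trans wz zy.
Qed.

Lemma lt_closed_natle I p q : lt_closed I -> idempotents Γ q -> I q -> p ≺ q ->
  I p.
Proof.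
move=> cI qi Iq pq; apply: (cI p [:: q]); first exact: idem_natle pq.
  by move=> r; rewrite inE => /eqP ->.
exact: covered_natle.
Qed.

Let idem_natleM e f g : idempotents Γ e -> e ≺ f -> e ≺ g -> e ≺ f * g.
Proof. by move=> ei ef eg; rewrite -ei; apply: natleM. Qed.

Let conjK x e : idempotents Γ e -> e ≺ x^-1 * x ->
  x^-1 * (x * e * x^-1) * x = e.
Proof.
move=> ei ex; have h := natle_lE ex; rewrite (isinv_idem ei) ei in h.
have -> : x^-1 * (x * e * x^-1) * x = x^-1 * x * e * (x^-1 * x).
  by rewrite !monoid.mulgA.
rewrite (idemC (idem_Vmul x) ei).
by rewrite -(monoid.mulgA e) (idem_Vmul x) -h.
Qed.

Lemma Cl_conj_invariant I : I `<=` idempotents Γ ->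
  (forall p q, I q -> p ≺ q -> I p) ->
  conj_invariant I -> conj_invariant (Cl I).
Proof.
move=> Ii dI vI p x [pi [s sI [s0 ps]]] px; split; first exact: idem_conj.
pose r q := x * (q * (x^-1 * x)) * x^-1.
have xxi := idem_Vmul x.
exists (map r s).
  move=> _ /mapP[q qs ->]; have qi := Ii _ (sI _ qs); apply: vI.
    by apply: (dI _ _ (sI _ qs)); apply: natle_mulr.
  exact: natle_mull.
split; first by case: (s) s0.
move=> y yp y0; have yi : idempotents Γ y.
  by apply: idem_natle yp; apply: idem_conj.
have yx : y ≺ x^-1^-1 * x^-1.
  rewrite isinvK; apply: natle_trans yp _; rewrite -monoid.mulgA.
  by apply: natleM; [apply: natle_refl | apply: natle_mull].
have yE := conjK yi yx; rewrite isinvK in yE.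
pose w := x^-1 * y * x; rewrite -/w in yE.
have wi : idempotents Γ w by apply: idem_conjV.
have wp : w ≺ p.
  have <- : x^-1 * (x * p * x^-1) * x = p by apply: conjK.
  by apply: natleM; [apply: natleM|]; rewrite //; apply: natle_refl.
have wx : w ≺ x^-1 * x := natle_trans wp px.
have w0 : nonzero w.
  by move=> wz; apply: y0; rewrite -yE (is_zero_mull x wz) (is_zero_mulr _ wz).
have [z [z0 zw [q qs zq]]] := ps _ wp w0.
have zi : idempotents Γ z := idem_natle wi zw.
have zx : z ≺ x^-1 * x := natle_trans zw wx.
exists (x * z * x^-1); split.
- move=> zz; apply: z0; rewrite -(conjK zi zx).
  by rewrite (is_zero_mull _ zz) (is_zero_mulr _ zz).
- rewrite -yE; apply: natleM; last exact: natle_refl.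
  by apply: natleM => //; apply: natle_refl.
- exists (r q); first exact: map_f.
  apply: natleM; last exact: natle_refl.
  by apply: natleM; [apply: natle_refl | apply: idem_natleM].
Qed.

Lemma calI_meet_closed I J : calI Γ I -> calI Γ J -> calI Γ (I `&` J).
Proof.
move=> [Ii [p Ip] cI vI] [Ji [q Jq] cJ vJ]; split.
- by move=> r [/Ii].
- have pi := Ii _ Ip; have qi := Ji _ Jq; exists (p * q); split.
    exact: (lt_closed_natle cI pi Ip (natle_mulr _ qi)).
  exact: (lt_closed_natle cJ qi Jq (natle_mull _ pi)).
- move=> r s ri sIJ rs.
  by split; [apply: cI ri _ rs | apply: cJ ri _ rs] => t /sIJ[].
- by move=> r x [Ir Jr] rx; split; [apply: vI | apply: vJ].
Qed.

Lemma calI_join_closed I J : calI Γ I -> calI Γ J -> calI Γ (Cl (I `|` J)).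
Proof.
move=> [Ii [p Ip] cI vI] [Ji _ cJ vJ].
have IJi : I `|` J `<=` idempotents Γ by rewrite subUset.
split.
- by move=> r [].
- by exists p; apply: sub_Cl => //; left.
- exact: Cl_lt_closed.
- apply: Cl_conj_invariant => // [r q [Iq|Jq] rq|r x [Ir|Jr] rx].
  + by left; apply: (lt_closed_natle cI _ Iq rq); apply: Ii.
  + by right; apply: (lt_closed_natle cJ _ Jq rq); apply: Ji.
  + by left; apply: vI.
  + by right; apply: vJ.
Qed.

Lemma Cl_sub I K : calI Γ K -> I `<=` K -> Cl I `<=` K.
Proof.
by move=> [_ _ cK _] IK p [pi [s sI ps]]; apply: cK pi _ ps => q /sI/IK.
Qed.

End LatticeI.

Import SetOrder.Exports.

Definition latticeI (Γ : inverseSemigroupType) : Type := set_type (calI Γ).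

HB.instance Definition _ Γ := SubChoice.on (latticeI Γ).
HB.instance Definition _ Γ :=
  Order.SubChoice_isSubPOrder.Build _ _ _ set_display (latticeI Γ).

Section LatticeIInstance.
Variable Γ : inverseSemigroupType.
Implicit Types I J K : latticeI Γ.

Lemma latticeI_leP I J : reflect (val I `<=` val J) (I <= J)%O.
Proof. by rewrite -Order.le_val; apply: (iffP idP); rewrite subsetEset. Qed.

Definition latticeI_meet I J : latticeI Γ :=
  exist _ (val I `&` val J)
    (mem_set (calI_meet_closed (set_valP I) (set_valP J))).

Definition latticeI_join I J : latticeI Γ :=
  exist _ (Cl (val I `|` val J))
    (mem_set (calI_join_closed (set_valP I) (set_valP J))).

Lemma latticeI_meetP I J K :
  (I <= latticeI_meet J K)%O = (I <= J)%O && (I <= K)%O.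
Proof.
apply/latticeI_leP/andP => [|[/latticeI_leP h1 /latticeI_leP h2]].
  by rewrite subsetI => -[h1 h2]; split; apply/latticeI_leP.
by rewrite subsetI.
Qed.

Lemma latticeI_joinP I J K :
  (latticeI_join I J <= K)%O = (I <= K)%O && (J <= K)%O.
Proof.
have [Ii _ _ _] := set_valP I; have [Ji _ _ _] := set_valP J.
have IJi : val I `|` val J `<=` idempotents Γ by rewrite subUset.
apply/latticeI_leP/andP => [h|[/latticeI_leP h1 /latticeI_leP h2]].
  have := subset_trans (sub_Cl IJi) h.
  by rewrite subUset => -[h1 h2]; split; apply/latticeI_leP.
by apply: Cl_sub; [apply: set_valP | rewrite subUset].
Qed.

HB.instance Definition _ := Order.POrder_MeetJoin_isLattice.Build set_display
  (latticeI Γ) latticeI_meetP latticeI_joinP.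

Lemma latticeI_meetE I J : val (I `&` J)%O = val I `&` val J.
Proof. by []. Qed.

Lemma latticeI_joinE I J : val (I `|` J)%O = Cl (val I `|` val J).
Proof. by []. Qed.

End LatticeIInstance.

Section LatticeV.
Variable Γ : inverseSemigroupType.
Implicit Types V W : set (dirclass Γ).

Lemma calV_meet_closed V W : calV Γ V -> calV Γ W -> calV Γ (V `&` W).
Proof.
move=> [Vo [Vu Vi]] [Wo [Wu Wi]]; split; first exact: openI.
split; first by move=> X [/Vu].
by move=> g Gg [gV gW]; split; [apply: Vi | apply: Wi].
Qed.

Lemma calV_join_closed V W : calV Γ V -> calV Γ W -> calV Γ (V `|` W).
Proof.
move=> [Vo [Vu Vi]] [Wo [Wu Wi]]; split; first exact: openU.
split; first by rewrite subUset.
by move=> g Gg [gV|gW]; [left; apply: Vi | right; apply: Wi].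
Qed.

End LatticeV.

Definition latticeV (Γ : inverseSemigroupType) : Type := set_type (calV Γ).

HB.instance Definition _ Γ := SubChoice.on (latticeV Γ).
HB.instance Definition _ Γ :=
  Order.SubChoice_isSubPOrder.Build _ _ _ set_display (latticeV Γ).

Section LatticeVInstance.
Variable Γ : inverseSemigroupType.
Implicit Types U V W : latticeV Γ.

Lemma latticeV_leP U V : reflect (val U `<=` val V) (U <= V)%O.
Proof. by rewrite -Order.le_val; apply: (iffP idP); rewrite subsetEset. Qed.

Definition latticeV_meet U V : latticeV Γ :=
  exist _ (val U `&` val V)
    (mem_set (calV_meet_closed (set_valP U) (set_valP V))).

Definition latticeV_join U V : latticeV Γ :=
  exist _ (val U `|` val V)
    (mem_set (calV_join_closed (set_valP U) (set_valP V))).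

Lemma latticeV_meetP U V W :
  (U <= latticeV_meet V W)%O = (U <= V)%O && (U <= W)%O.
Proof.
apply/latticeV_leP/andP => [|[/latticeV_leP h1 /latticeV_leP h2]].
  by rewrite subsetI => -[h1 h2]; split; apply/latticeV_leP.
by rewrite subsetI.
Qed.

Lemma latticeV_joinP U V W :
  (latticeV_join U V <= W)%O = (U <= W)%O && (V <= W)%O.
Proof.
apply/latticeV_leP/andP => [|[/latticeV_leP h1 /latticeV_leP h2]].
  by rewrite subUset => -[h1 h2]; split; apply/latticeV_leP.
by rewrite subUset.
Qed.

HB.instance Definition _ := Order.POrder_MeetJoin_isLattice.Build set_display
  (latticeV Γ) latticeV_meetP latticeV_joinP.

Lemma latticeV_meetE U V : val (U `&` V)%O = val U `&` val V.
Proof. by []. Qed.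

Lemma latticeV_joinE U V : val (U `|` V)%O = val U `|` val V.
Proof. by []. Qed.

End LatticeVInstance.

Definition Si (Γ : inverseSemigroupType) (V : set (dirclass Γ)) : set Γ :=
  [set q | idempotents Γ q /\ Vset q `<=` V].

Definition Su (Γ : inverseSemigroupType) (I : set Γ) : set (dirclass Γ) :=
  \bigcup_(q in I) Vset q.

(* Main.v *)
(** Classes in G_m(Γ)^(0) behave like ultrafilters of idempotents: a minimal
    idempotent X satisfies X ≺ q or Xq = 0 for each idempotent q. Hence
    p < (q_1, ..., q_n) gives V_p ⊂ V_{q_1} ∪ ... ∪ V_{q_n}, and every
    neighbourhood of X in G_m(Γ)^(0) contains some V_q ∋ X. Conversely, let V_q be
    covered by the V_r with r ∈ I, while q < (r_1, ..., r_n) fails for all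
    r_1, ..., r_n ∈ I. By Zorn's lemma the sets V_q \ (V_{r_1} ∪ ... ∪ V_{r_n})
    are then nonempty; an ultrafilter containing all of them converges in U_q
    to an idempotent class, which is minimal because G_m(Γ)^(0) is closed, and
    which lies in V_q but in no V_r: a contradiction. Both maps are monotone, so
    mutually inverse ones are lattice isomorphisms. *)

Require Import Defs.
From HB Require Import structures.
From mathcomp Require Import all_boot all_order all_algebra.
From mathcomp Require Import boolp classical_sets topology.

(* Restores [_^-1] as [isinv], shadowed by the imports above. *)
Import Defs.

Set Implicit Arguments.
Unset Strict Implicit.
Unset Printing Implicit Defensive.

Section Classes.
Local Open Scope classical_set_scope.
Local Open Scope group_scope.
Variable Γ : inverseSemigroupType.
Implicit Types (a b c x y p q e z : Γ) (X Y g : dirclass Γ) (I : set Γ).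

(** * Classes of directed sets and the elements above them *)

Lemma dirclass_exists_principal X : exists a, X ≺ principal a.
Proof.
elim/dirclassW: X => A; have [[a Aa] _] := dsetP A; exists a.
by apply/dirclass_natle => _ ->; exists a => //; apply: natle_refl.
Qed.

Lemma dirclass_common_principal X a b : X ≺ principal a -> X ≺ principal b ->
  exists c, [/\ c ≺ a, c ≺ b & X ≺ principal c].
Proof.
elim/dirclassW: X => A.
move=> /dirclass_natle/(_ a erefl)[a' Aa' aa].
move=> /dirclass_natle/(_ b erefl)[b' Ab' bb].
have [_ dA] := dsetP A; have [c Ac [ca cb]] := dA _ _ Aa' Ab'; exists c.
split; [exact: natle_trans ca aa | exact: natle_trans cb bb |].
by apply/dirclass_natle => _ ->; exists c => //; apply: natle_refl.
Qed.

(** Every member of a representative of [Y] lies above [Y], so a class is determined by the filter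
    of elements above it. *)
Lemma dirclass_natle_principal X Y :
  (forall a, Y ≺ principal a -> X ≺ principal a) -> X ≺ Y.
Proof.
elim/dirclassW: X => A; elim/dirclassW: Y => B h; apply/dirclass_natle => b Bb.
suff /h/dirclass_natle/(_ b erefl) : dirclass_of B ≺ principal b by [].
by apply/dirclass_natle => _ ->; exists b => //; apply: natle_refl.
Qed.

Lemma principal_zero x : is_zero (principal x) <-> is_zero x.
Proof.
split=> x0 => [y|X]; first by apply/principal_natle/x0.
by apply: dirclass_natle_principal => a _; apply/principal_natle/x0.
Qed.

Lemma nonzero_principal X a : nonzero X -> X ≺ principal a -> nonzero a.
Proof. by move=> X0 Xa /principal_zero/is_zero_natle/(_ Xa)/X0. Qed.

Lemma principal_idem e : idempotents Γ e ->
  idempotents (dirclass Γ) (principal e).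
Proof. by rewrite /idempotents /= -principalM => ->. Qed.

(** The product is represented by the elements [a * q], one of which must lie below the zero of [Γ];
    vanishing is thus visible on a single element above [X]. *)
Lemma dirclass_zero_mul X q : (exists z, is_zero z) -> is_zero (X * principal q) ->
  exists2 a, X ≺ principal a & is_zero (a * q).
Proof.
move=> [z z0] /(_ (principal z)); elim/dirclassW: X => A.
rewrite /principal -dirclass_ofM => /dirclass_natle/(_ z erefl).
move=> [_ [a Aa [_ -> <-]] aqz]; exists a; last exact: is_zero_natle z0 aqz.
by apply/dirclass_natle => _ ->; exists a => //; apply: natle_refl.
Qed.

(** * Units of [Gm Γ] as minimal idempotent classes *)

Lemma minimal_source g : minimal_elements (dirclass Γ) g ->
  minimal_elements (dirclass Γ) (g * g^-1).
Proof.
move=> gm; apply: (@gset_mul _ (Gm Γ)) => //; first exact: (@gset_inv _ (Gm Γ)).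
by rewrite /= /rcomp isinvK.
Qed.

Lemma gunits_GmP X :
  gunits (Gm Γ) X <->
  idempotents (dirclass Γ) X /\ minimal_elements (dirclass Γ) X.
Proof.
split=> [[Y Ym <-]|[Xi Xm]].
  split; first exact: idem_mulV.
  exact: minimal_source.
by exists X => //=; rewrite (isinv_idem Xi) Xi.
Qed.

Lemma gunits_GuE : gunits (Gu Γ) = idempotents (dirclass Γ).
Proof.
apply/seteqP; split=> [_ [Y _ <-]|X Xi]; first exact: idem_mulV.
by exists X => //=; rewrite (isinv_idem Xi) Xi.
Qed.

Lemma Vset_idem X q : idempotents Γ q -> Vset q X -> idempotents (dirclass Γ) X.
Proof. by move=> /principal_idem qi [Xq _]; apply: idem_natle Xq. Qed.

Lemma Vset_gunits q : idempotents Γ q -> Vset q `<=` gunits (Gm Γ).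
Proof.
by move=> qi X Xq; apply/gunits_GmP; split; [apply: Vset_idem Xq | case: Xq].
Qed.

(** The product lies below [X], so minimality leaves only [X] itself and zero. *)
Lemma minimal_mul_principal X q : gunits (Gm Γ) X -> idempotents Γ q ->
  X ≺ principal q \/ is_zero (X * principal q).
Proof.
move=> /gunits_GmP[Xi [X0 Xmin]] /principal_idem qi.
have [z|nz] := pselect (is_zero (X * principal q)); [by right | left].
by rewrite -(Xmin _ (natle_mulr _ qi) nz); apply: natle_mull.
Qed.

(** For each [q] some element above [X] annihilates [q]; finitely many such elements have a common
    precessor still above [X]. *)
Lemma dirclass_annihilator X p (s : seq Γ) : (exists z, is_zero z) ->
  gunits (Gm Γ) X -> X ≺ principal p ->
  (forall q, q \in s -> idempotents Γ q /\ ~ X ≺ principal q) ->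
  exists a, [/\ a ≺ p, X ≺ principal a &
    forall q, q \in s -> is_zero (a * q)].
Proof.
move=> zΓ Xu Xp; elim: s => [|q s IHs] nX.
  by exists p; split=> //; apply: natle_refl.
have [qi nXq] := nX q (mem_head _ _).
have [t ts|a [ap Xa az]] := IHs; first by apply: nX; rewrite inE ts orbT.
have [//|Xq0] := minimal_mul_principal Xu qi.
have [b Xb bq] := dirclass_zero_mul zΓ Xq0.
have [c [ca cb Xc]] := dirclass_common_principal Xa Xb.
exists c; split=> //; first exact: natle_trans ca ap.
move=> t; rewrite inE => /orP[/eqP ->|/az atz].
  by apply: is_zero_natle bq _; apply: natleM cb _; apply: natle_refl.
by apply: is_zero_natle atz _; apply: natleM ca _; apply: natle_refl.
Qed.

(** Each [h ≺ g] equals [h * h^-1 * g], and for nonzero [h] minimality of [g * g^-1] forces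
    [h * h^-1 = g * g^-1]. *)
Lemma minimal_of_source g : minimal_elements (dirclass Γ) (g * g^-1) ->
  minimal_elements (dirclass Γ) g.
Proof.
move=> [g0 gmin]; split=> [gz|h hg h0].
  by apply: g0; rewrite (is_zero_mulr _ gz).
have hh : h * h^-1 = g * g^-1.
  apply: gmin; first by apply: natleM => //; apply: natleV.
  by move=> hz; apply: h0; rewrite -(isinvK1 h) (is_zero_mulr _ hz).
by rewrite (natle_lE hg) hh isinvK1.
Qed.

(** * Existence of minimal classes by Zorn's lemma *)

Lemma minimal_below (y : Γ) : (exists z : Γ, is_zero z) -> nonzero y ->
  exists X, X ≺ principal y /\ minimal_elements (dirclass Γ) X.
Proof.
move=> [z z0] y0.
pose P X := nonzero X /\ X ≺ principal y.
have Py : P (principal y).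
  by split; [move=> /principal_zero | apply: natle_refl].
(* [R] reverses the order on the nonzero classes below [y], so a maximal element for [R] is a
   minimal class. *)
pose T := {X | P X}; pose R (X Y : T) := `[< sval Y ≺ sval X >].
have [||| C totC|[X PX] maxX] := @Zorn T R.
- by move=> X; apply/asboolP/natle_refl.
- move=> X Y Z /asboolP YX /asboolP ZY; apply/asboolP; exact: natle_trans ZY YX.
- case=> X PX [Y PY] /asboolP/= YX /asboolP/= XY; apply: eq_exist => /=.
  exact: natle_anti.
- have [[X0 CX0]|C0] := pselect (C !=set0); last first.
    exists (exist _ _ Py) => X CX; case: C0; by exists X.
  (* The filters of the members of the chain have a directed union, whose class [L] is a lower bound
     of the chain. *)
  pose A := [set a | exists2 X, C X & sval X ≺ principal a].
  have dA : directed A.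
    split.
      by have [a Xa] := dirclass_exists_principal (sval X0); exists a, X0.
    move=> a b [X CX Xa] [Y CY Yb].
    have [Z [CZ Za Zb]] : exists Z, [/\ C Z, sval Z ≺ principal a
        & sval Z ≺ principal b].
      by case: (totC X Y CX CY) => /asboolP XY; [exists Y | exists X];
        split=> //; apply: natle_trans XY _.
    by have [c [ca cb Zc]] := dirclass_common_principal Za Zb;
      exists c => //; exists Z.
  pose L := dirclass_of (Dirset dA).
  have LE a : L ≺ principal a <-> A a.
    split=> [/dirclass_natle/(_ a erefl)[b [X CX Xb] ba]|Aa].
      by exists X => //; apply: natle_trans Xb _; apply/principal_natle.
    by apply/dirclass_natle => _ ->; exists a => //; apply: natle_refl.
  have LC (X : T) : C X -> L ≺ sval X.
    move=> CX; apply: dirclass_natle_principal => a Xa; apply/LE.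
    by exists X.
  have PL : P L.
    (* A zero [L] would put [z] into [A], so some member of the chain would already be zero. *)
    split=> [L0|]; last by apply: natle_trans (LC _ CX0) _; case: (svalP X0).
    have /LE[X CX /(nonzero_principal _)] := L0 (principal z).
    by case: (svalP X) => + _ => /[swap]/[apply]; apply.
  by exists (exist _ _ PL) => X CX; apply/asboolP/LC.
- exists X; split; first exact: (proj2 PX).
  split=> [|Y YX Y0]; first exact: (proj1 PX).
  have PY : P Y by split=> //; apply: natle_trans YX (proj2 PX).
  by apply: (congr1 sval (maxX (exist _ _ PY) _)); apply/asboolP.
Qed.

(** * Basic open sets, closedness of the units, limits of ultrafilters *)

Lemma open_basisP (V : set (dirclass Γ)) : open V <->
  exists2 D, D `<=` @Gu_basis Γ & \bigcup_(B in D) B = V.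
Proof. by []. Qed.

Lemma Uset_basis x : Gu_basis (Uset x).
Proof.
exists x, [::]; split=> //; apply/seteqP; split=> [X Xx|X []//].
by split.
Qed.

Lemma Uset_open x : open (Uset x).
Proof.
apply/open_basisP; exists [set Uset x]; last by rewrite bigcup_set1.
by move=> _ ->; apply: Uset_basis.
Qed.

Lemma open_basis_nbhs (V : set (dirclass Γ)) X : open V -> V X ->
  exists B, [/\ Gu_basis B, B X & B `<=` V].
Proof.
move=> /open_basisP[D DB <-] [B /[dup] DB' /DB BB BX].
by exists B; split=> // Y BY; exists B.
Qed.

(** [LC] gives closedness only relative to the units of [Gu Γ]; there the units of [Gm Γ] are cut
    out by a closed set [C] of the whole space, so adherence can be tested on the basis. *)
Lemma units_closed X : LC Γ -> idempotents (dirclass Γ) X ->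
  (forall B, Gu_basis B -> B X -> B `&` gunits (Gm Γ) !=set0) ->
  gunits (Gm Γ) X.
Proof.
move=> [_ _ /closed_subspaceP[C Ccl CE]] Xi Xcl.
have idE Y : idempotents (dirclass Γ) Y -> C Y <-> gunits (Gm Γ) Y.
  move=> Yi.
  have : (C `&` gunits (Gu Γ)) Y <-> (gunits (Gm Γ) `&` gunits (Gu Γ)) Y.
    by rewrite CE.
  by rewrite gunits_GuE => -[h1 h2]; split=> [CY|UY]; [case: h1|case: h2].
apply/idE => //; apply: contrapT => nCX.
have [B [BB BX BC]] := open_basis_nbhs (closed_openC Ccl) nCX.
have [Y [/BC + UY]] := Xcl _ BB BX.
by apply; apply/idE => //; case/gunits_GmP: UY.
Qed.

(** Being below an idempotent, [X] is idempotent, so [X = X * X] lies below the product. *)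
Lemma Uset_mulr e y X : X ≺ principal e -> idempotents Γ e ->
  Uset y X -> Uset (e * y) X.
Proof.
rewrite /Uset /= principalM => Xe /principal_idem ei Xy.
have Xi := idem_natle ei Xe.
by rewrite -Xi; apply: natleM.
Qed.

(* The limit is the class of the filter of idempotents [e] with [U_e] in [F]. *)
Lemma ultrafilter_cvg (F : set_system (dirclass Γ)) q : UltraFilter F ->
  idempotents Γ q -> F (Uset q) ->
  exists X, [/\ idempotents (dirclass Γ) X, X ≺ principal q &
    forall B, Gu_basis B -> B X -> F B].
Proof.
move=> FU qi Fq.
pose A := [set e | idempotents Γ e /\ F (Uset e)].
have UsetS x y : x ≺ y -> Uset x `<=` Uset y.
  by move=> xy X Xx; apply: natle_trans Xx _; apply/principal_natle.
have dA : directed A.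
  split; first by exists q.
  move=> e f [ei Fe] [fi Ff]; exists (e * f).
    split; first exact: idemM.
    by apply: filterS (filterI Fe Ff) => X [Xe Xf]; apply: Uset_mulr.
  by split; [apply: natle_mulr | apply: natle_mull].
pose X := dirclass_of (Dirset dA).
have XE a : X ≺ principal a <-> exists2 e, A e & e ≺ a.
  split=> [/dirclass_natle/(_ a erefl)//|Aa].
  by apply/dirclass_natle => _ ->.
have Xq : X ≺ principal q by apply/XE; exists q => //; apply: natle_refl.
exists X; split=> //.
  by apply: idem_natle Xq; apply: principal_idem.
move=> _ [x [s [sx ->]]] [/XE[e [ei Fe] ex] Xs].
apply: filterI; first exact: filterS (UsetS _ _ ex) Fe.
(* If [Uset y] were in [F], the idempotent [e * y ≺ e * x = e] would belong to [A] and force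
   [X ≺ principal y]. *)
have {}Xs : forall y, y \in s -> F (~` Uset y).
  move=> y ys; have [Fy|//] := in_ultra_setVsetC (Uset y) FU.
  case: (Xs _ ys); apply/XE; exists (e * y); last exact: natle_mull.
  have eyx : e * y ≺ e.
    have ee := natle_lE ex; rewrite (isinv_idem ei) ei in ee.
    by rewrite {2}ee; apply: natleM (sx _ ys); apply: natle_refl.
  split; first exact: idem_natle eyx.
  by apply: filterS (filterI Fe Fy) => Y [Ye Yy]; apply: Uset_mulr.
elim: s {sx} Xs => [|y s IHs] Xs.
  by apply: filterS filterT => Y _ y.
have Fs : F (\bigcap_(y in [set` s]) ~` Uset y).
  by apply: IHs => z zs; apply: Xs; rewrite inE zs orbT.
apply: filterS (filterI (Xs y (mem_head _ _)) Fs) => Y [Yy Ys] z /=.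
by rewrite inE => /orP[/eqP ->//|zs]; apply: Ys.
Qed.

(** * Coverings of elements and coverings of the sets [Vset q] *)

(** In effect this is compactness of [Vset q]; it yields the hard inclusion of [Si (Su I)] in
    [I]. *)
Lemma covered_of_Vset I q : LC Γ -> I `<=` idempotents Γ -> I !=set0 ->
  idempotents Γ q -> Vset q `<=` Su I ->
  exists2 s : seq Γ, (forall r, r \in s -> I r) & covered q s.
Proof.
move=> hLC Ii [i Ii0] qi qI; have [zΓ _ _] := hLC.
apply: contrapT => ncov.
pose D := [set s : seq Γ | forall r, r \in s -> I r].
pose B (s : seq Γ) := Vset q `&` \bigcap_(r in [set` s]) ~` Uset r.
have Bne s : D s -> B s !=set0.
  (* The extra [i] keeps the list nonempty, as [covered] demands, when [s] is empty. *)
  move=> Ds; have : ~ covered q (i :: s).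
    by move=> cov; apply: ncov; exists (i :: s) => // r;
      rewrite inE => /orP[/eqP ->//|/Ds].
  move=> /not_andP[]// /existsNP[y /not_implyP[yq /not_implyP[y0 nz]]].
  (* No [r] in [s] has a nonzero common precessor with [y], so a minimal class below [y] avoids
     every [Uset r]. *)
  have [X [Xy Xm]] := minimal_below zΓ y0.
  exists X; split.
    by split=> //; apply: natle_trans Xy _; apply/principal_natle.
  move=> r rs Xr; apply: nz.
  have [c [cy cr Xc]] := dirclass_common_principal Xy Xr.
  exists c; split=> //; first by apply: nonzero_principal Xc; case: Xm.
  by exists r => //; rewrite inE rs orbT.
have FB : ProperFilter (filter_from D B).
  apply: filter_from_proper => //; apply: filter_from_filter; first by exists [::].
  move=> s t Ds Dt; exists (s ++ t).
    by move=> r; rewrite mem_cat => /orP[/Ds|/Dt].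
  by move=> X [Xq Xst]; split; split=> // r rs; apply: Xst;
    rewrite /= mem_cat rs ?orbT.
have [F [FU FBF]] := ultraFilterLemma FB.
have FBs s : D s -> F (B s) by move=> Ds; apply: FBF; exists s.
have FV : F (Vset q) by apply: filterS (FBs [::] _) => [X []|].
have [|X [Xi Xq Xcl]] := ultrafilter_cvg FU qi.
  by apply: filterS FV => X [].
(* Each basic neighbourhood of [X] is in [F], hence meets [Vset q], which consists of units of
   [Gm Γ]. *)
have Xu : gunits (Gm Γ) X.
  apply: units_closed => // C CB CX.
  have [Y [VY CY]] := filter_ex (filterI FV (Xcl _ CB CX)).
  by exists Y; split=> //; apply: Vset_gunits VY.
have [|r Ir [Xr _]] := qI X; first by split=> //; case/gunits_GmP: Xu.
(* [F] contains [Uset r] and also [B [:: r]], which is disjoint from it. *)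
have Fr := Xcl _ (Uset_basis r) Xr.
have [|Y [[_ Yr] Yr']] := filter_ex (filterI (FBs [:: r] _) Fr).
  by move=> t; rewrite inE => /eqP ->.
by apply: Yr Yr'; rewrite /= inE.
Qed.

(** If [X] avoided every [q] in [s], some [a ≺ p] above [X] would annihilate all of them; the
    covering gives a nonzero idempotent [z] below [a] and some [q], so [z = z * z ≺ a * q] would be
    zero. *)
Lemma Vset_covered p (s : seq Γ) : (exists z, is_zero z) -> idempotents Γ p ->
  (forall q, q \in s -> idempotents Γ q) -> covered p s ->
  Vset p `<=` Su [set` s].
Proof.
move=> zΓ pi si [_ ps] X /[dup] Vp [Xp Xm]; apply: contrapT => nX.
have Xu := Vset_gunits pi Vp.
have [|a [ap Xa as0]] := dirclass_annihilator zΓ Xu Xp (s:=s).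
  by move=> q qs; split; [apply: si | move=> Xq; apply: nX; exists q].
have a0 : nonzero a by apply: nonzero_principal Xa; case: Xm.
have [z [z0 za [q qs zq]]] := ps _ ap a0.
apply: z0; apply: is_zero_natle (as0 _ qs) _.
have <- : z * z = z by apply: (idem_natle pi); apply: natle_trans za ap.
exact: natleM.
Qed.

(** * The maps [Si] and [Su] and their composites *)

Lemma Si_calI V : LC Γ -> calV Γ V -> calI Γ (Si V).
Proof.
move=> [zΓ _ _] [_ [_ Vi]]; split.
- by move=> q [].
(* The zero is a member because [Vset z] is empty. *)
- have [z z0] := zΓ; exists z; split; first exact: is_zero_idem.
  move=> X [Xz [X0 _]]; case: X0; apply: is_zero_natle Xz.
  exact/principal_zero.
- move=> p s pi sV ps; split=> // X.
  move=> /(Vset_covered zΓ pi (fun q qs => proj1 (sV q qs)) ps)[q qs].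
  exact: (proj2 (sV q qs)).
- move=> p x [pi pV] px; split; first exact: idem_conj.
  move=> X [Xp Xm].
  have Xi := Vset_idem (idem_conj x pi) (conj Xp Xm).
  (* This arrow of [Gm Γ] has [g * g^-1 = X], while [g^-1 * g] lies in [Vset p], so invariance of
     [V] carries membership over to [X]. *)
  pose g := X * principal x.
  have Xxx : X ≺ principal (x * x^-1).
    apply: natle_trans Xp _; apply/principal_natle; rewrite -monoid.mulgA.
    by apply: natleM; [apply: natle_refl | apply: natle_mull].
  have gg : g * g^-1 = X.
    rewrite /g isinvM (isinv_idem Xi) -principalV.
    have -> : X * principal x * (principal x^-1 * X) = X * principal (x * x^-1) * X.
      by rewrite principalM !monoid.mulgA.
    have := natle_lE Xxx; rewrite (isinv_idem Xi) Xi => <-; exact: Xi.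
  have gm : minimal_elements (dirclass Γ) g.
    by apply: minimal_of_source; rewrite gg.
  rewrite -gg; apply: (Vi g gm); apply: pV; split; last first.
    by have := minimal_source ((@gset_inv _ (Gm Γ)) g gm); rewrite isinvK.
  have pE : p = x^-1 * (x * p * x^-1) * x.
    have -> : x^-1 * (x * p * x^-1) * x = x^-1 * x * p * (x^-1 * x).
      by rewrite !monoid.mulgA.
    have pE := natle_lE px; rewrite (isinv_idem pi) pi in pE.
    by rewrite (idemC (idem_Vmul x) pi) -monoid.mulgA idem_Vmul.
  rewrite /Uset /= pE (principalM _ x) (principalM x^-1) principalV.
  rewrite /g isinvM (isinv_idem Xi).
  set x' := principal x.
  have -> : x'^-1 * X * (X * x') = x'^-1 * (X * X) * x' by rewrite !monoid.mulgA.
  rewrite Xi; apply: natleM; last exact: natle_refl.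
  by apply: natleM => //; apply: natle_refl.
Qed.

Lemma Su_calV I : calI Γ I -> calV Γ (Su I).
Proof.
move=> [Ii _ cI vI].
(* Openness becomes visible once [Su I] is the trace of an open set on the units. *)
have SuE : Su I = (\bigcup_(q in I) Uset q) `&` gunits (Gm Γ).
  apply/seteqP; split=> [X [q Iq VX]|X [[q Iq Uq] /gunits_GmP[_ Xm]]].
    by split; [exists q => //; case: VX | apply: Vset_gunits VX; apply: Ii].
  by exists q.
split.
  rewrite SuE open_subspaceIT; apply: open_subspaceW.
  by apply: bigcup_open => q _; apply: Uset_open.
split; first by rewrite SuE; apply: subIsetr.
move=> g gm [q Iq [gq _]].
have qi := Ii _ Iq.
have [b gb] := dirclass_exists_principal g.
(* Invariance of [I] applies only below [b^-1 * b], so [q] is cut down; [p] stays above [g^-1 * g],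
   and conjugating by [b] gives an element above [g * g^-1]. *)
pose p := q * (b^-1 * b).
have Ip : I p.
  by apply: (lt_closed_natle cI qi Iq); apply/natle_mulr/idem_Vmul.
have pb : p ≺ b^-1 * b by apply: natle_mull.
exists (b * p * b^-1); first exact: vI.
split; last exact: minimal_source.
have ggp : g^-1 * g ≺ principal p.
  rewrite -(idem_Vmul g) !principalM principalV.
  by apply: natleM => //; apply: natleM => //; apply: natleV.
rewrite /Uset /= (principalM (b * p)) (principalM b) principalV.
have -> : g * g^-1 = g * (g^-1 * g) * g^-1 by rewrite monoid.mulgA isinvK1.
by apply: natleM; [apply: natleM | apply: natleV].
Qed.

Lemma Su_Si V : LC Γ -> calV Γ V -> Su (Si V) = V.
Proof.
move=> [zΓ _ _] [Vo [Vu _]]; apply/seteqP; split=> [X [q [_ qV] /qV]//|X VX].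
have Xu := Vu _ VX; have /gunits_GmP[Xi Xm] := Xu.
have [W Wo WV] : exists2 W : set (dirclass Γ), open W &
    W `&` gunits (Gm Γ) = V `&` gunits (Gm Γ).
  by have /open_subspaceP := Vo.
have WX : W X by have : (V `&` gunits (Gm Γ)) X by []; rewrite -WV => -[].
have [_ [[x [s [sx ->]]] [Xx Xs] BW]] := open_basis_nbhs Wo WX.
(* [x] need not be idempotent; it is replaced by an idempotent between [X] and [x]. *)
have [e [ei ex Xe]] : exists e, [/\ idempotents Γ e, e ≺ x & X ≺ principal e].
  have [a Xa] := dirclass_exists_principal X.
  have Xaa : X ≺ principal (a * a^-1).
    rewrite principalM principalV -Xi -{2}(isinv_idem Xi).
    by apply: natleM => //; apply: natleV.
  have [c [ca cx Xc]] := dirclass_common_principal Xaa Xx.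
  by exists c; split=> //; apply: idem_natle ca; apply: idem_mulV.
have eyi y : y \in s -> idempotents Γ (e * y).
  move=> ys; apply: (@idem_natle _ _ (e * x)).
    by have := natle_lE ex; rewrite (isinv_idem ei) ei => <-.
  by apply: natleM (sx _ ys); apply: natle_refl.
(* Since [q] annihilates each [e * y], the set [Vset q] misses every excluded [Uset y] and fits into
   the basic neighbourhood. *)
have [|q [qe Xq qs]] := dirclass_annihilator zΓ Xu Xe (s:=map (fun y => e * y) s).
  move=> _ /mapP[y ys ->]; split; first exact: eyi.
  move=> Xey; apply: (Xs y ys); apply: natle_trans Xey _.
  exact/principal_natle/natle_mull.
have qi := idem_natle ei qe.
exists q; last by split.
split=> // Y VY; have Yu := Vset_gunits qi VY; have [Yq [Y0 _]] := VY.
suff : (V `&` gunits (Gm Γ)) Y by case.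
rewrite -WV; split=> //; apply: BW; split.
  apply: natle_trans Yq _; apply/principal_natle; exact: natle_trans qe ex.
move=> y ys Yy; apply: Y0.
have Ye : Y ≺ principal e by apply: natle_trans Yq _; apply/principal_natle.
have := Uset_mulr Yq qi (Uset_mulr Ye ei Yy).
by apply: is_zero_natle; apply/principal_zero/qs/map_f.
Qed.

Lemma Si_Su I : LC Γ -> calI Γ I -> Si (Su I) = I.
Proof.
move=> hLC [Ii I0 cI _]; apply/seteqP; split=> [q [qi qI]|q Iq].
  by have [s sI qs] := covered_of_Vset hLC Ii I0 qi qI; apply: cI qs.
by split; [apply: Ii | move=> X VX; exists q].
Qed.

End Classes.

(** * Mutually inverse monotone maps preserve meets and joins *)

Section OrderIsomorphism.
Import Order.TTheory.
Local Open Scope order_scope.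
Variables (d d' : Order.disp_t) (L : latticeType d) (L' : latticeType d').
Variables (f : L -> L') (g : L' -> L).
Hypotheses (f_homo : {homo f : x y / x <= y}) (g_homo : {homo g : x y / x <= y}).
Hypotheses (fK : cancel f g) (gK : cancel g f).

Lemma order_iso_meet : Order.meet_morphism f.
Proof.
move=> x y; apply: le_anti; apply/andP; split.
  by rewrite lexI !f_homo ?leIl ?leIr.
(* The meet of [f x] and [f y] is [f] of its image under [g], and that image lies below [x] and [y]
   by monotonicity of [g]. *)
rewrite -[leLHS]gK f_homo// lexI -{2}(fK x) -{3}(fK y).
by rewrite !g_homo ?leIl ?leIr.
Qed.

Lemma order_iso_join : Order.join_morphism f.
Proof.
move=> x y; apply: le_anti; apply/andP; split; last first.
  by rewrite leUx !f_homo ?leUl ?leUr.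
rewrite -[leRHS]gK f_homo// leUx -{1}(fK x) -{2}(fK y).
by rewrite !g_homo ?leUl ?leUr.
Qed.

End OrderIsomorphism.

(** * [Su] and [Si] as lattice morphisms *)

Section LatticeIsomorphism.
Local Open Scope classical_set_scope.
Variables (Γ : inverseSemigroupType) (hLC : LC Γ).

Definition latticeI_Su (I : latticeI Γ) : latticeV Γ :=
  exist _ (Su (val I)) (mem_set (Su_calV (set_valP I))).

Definition latticeV_Si (V : latticeV Γ) : latticeI Γ :=
  exist _ (Si (val V)) (mem_set (Si_calI hLC (set_valP V))).

Lemma latticeI_Su_homo : {homo latticeI_Su : I J / (I <= J)%O}.
Proof.
move=> I J /latticeI_leP IJ; apply/latticeV_leP => X [q Iq VX].
by exists q => //; apply: IJ.
Qed.

Lemma latticeV_Si_homo : {homo latticeV_Si : V W / (V <= W)%O}.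
Proof.
move=> V W /latticeV_leP VW; apply/latticeI_leP => q [qi qV].
by split=> //; apply: subset_trans VW.
Qed.

Lemma latticeI_SuK : cancel latticeI_Su latticeV_Si.
Proof. by move=> I; apply: val_inj; apply: Si_Su => //; apply: set_valP. Qed.

Lemma latticeV_SiK : cancel latticeV_Si latticeI_Su.
Proof. by move=> V; apply: val_inj; apply: Su_Si => //; apply: set_valP. Qed.

HB.instance Definition _ :=
  Order.isOrderMorphism.Build _ _ _ _ latticeI_Su latticeI_Su_homo.
HB.instance Definition _ := Order.isLatticeMorphism.Build _ _ _ _ latticeI_Su
  (order_iso_meet latticeI_Su_homo latticeV_Si_homo latticeI_SuK latticeV_SiK)
  (order_iso_join latticeI_Su_homo latticeV_Si_homo latticeI_SuK latticeV_SiK).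
HB.instance Definition _ :=
  Order.isOrderMorphism.Build _ _ _ _ latticeV_Si latticeV_Si_homo.
HB.instance Definition _ := Order.isLatticeMorphism.Build _ _ _ _ latticeV_Si
  (order_iso_meet latticeV_Si_homo latticeI_Su_homo latticeV_SiK latticeI_SuK)
  (order_iso_join latticeV_Si_homo latticeI_Su_homo latticeV_SiK latticeI_SuK).

Definition Su_lmorphism : {lmorphism latticeI Γ -> latticeV Γ} := latticeI_Su.
Definition Si_lmorphism : {lmorphism latticeV Γ -> latticeI Γ} := latticeV_Si.

End LatticeIsomorphism.

Theorem lemma7p7 (Γ : inverseSemigroupType) (hLC : LC Γ) :
  [/\ forall V : set (dirclass Γ), calV Γ V -> calI Γ (Si V),
      forall I : set Γ, calI Γ I -> calV Γ (Su I)
    & exists (su : {lmorphism latticeI Γ -> latticeV Γ})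
             (si : {lmorphism latticeV Γ -> latticeI Γ}),
        [/\ forall I : latticeI Γ, val (su I) = Su (val I),
            forall V : latticeV Γ, val (si V) = Si (val V),
            cancel su si
          & cancel si su]].
Proof.
split=> [V|I|]; [exact: Si_calI | exact: Su_calV |].
exists (Su_lmorphism hLC), (Si_lmorphism hLC); split=> //.
- exact: latticeI_SuK.
- exact: latticeV_SiK.
Qed.
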